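(* Let $d,n\ge1$ be integers. The set $\mathfrak{L}^d_+$ is convex.
   Context: $\mathbb{T}=(-\pi,\pi]$, $\boldsymbol\theta=(\theta_1,\dots,\theta_d)\in\mathbb{T}^d$, $e^{i\boldsymbol\theta}=(e^{i\theta_1},\dots,e^{i\theta_d})$, $dm(\boldsymbol\theta)=(1/2\pi)^d\prod_{j=1}^d d\theta_j$. $\mathrm{C}^0_+(\mathbb{T}^d)$ is the set of strictly positive continuous functions on the $d$-torus $\mathbb{T}^d$. $K(e^{i\theta_k})=[1,e^{i\theta_k},\dots,e^{in\theta_k}]^\top$ and $K(e^{i\boldsymbol\theta})=K(e^{i\theta_1})\otimes\cdots\otimes K(e^{i\theta_d})\in\mathbb{C}^{(n+1)^d}$ (Kronecker product); $M^H$ denotes conjugate transpose. $\Gamma_d:\Phi\mapsto\int_{\mathbb{T}^d}K(e^{i\boldsymbol\theta})\Phi(e^{i\boldsymbol\theta})K^H(e^{i\boldsymbol\theta})\,dm(\boldsymbol\theta)$, for $\Phi\in \mathrm{C}^0_+(\mathbb{T}^d)$, and $\mathfrak{L}^d_+=\{\Lambda\in\operatorname{range}(\Gamma_d)\mid\Lambda\succ0\}$, where $\succ0$ means Hermitian positive definite. *)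

(* Defs.v *)
From HB Require Import structures.
From mathcomp Require Import all_boot all_order all_algebra.
From mathcomp Require Import spectral sesquilinear.
From mathcomp Require Import complex mxtens.
From mathcomp Require Import all_classical all_reals all_analysis.

Set Implicit Arguments.
Unset Strict Implicit.
Unset Printing Implicit Defensive.

Import Order.TTheory GRing.Theory Num.Theory.
Import numFieldNormedType.Exports.

Local Open Scope classical_set_scope.
Local Open Scope ring_scope.
Local Open Scope complex_scope.
Local Open Scope sesquilinear_scope.

Section TorusMeasure.
Context {R : realType}.

Definition angles : set (measurableTypeR R) := `]- pi, pi]%classic.

Lemma measurable_angles : measurable angles.
Proof. exact: measurable_itv. Qed.

Lemma inv2pi_ge0 : 0 <= (2 * pi)^-1 :> R.
Proof. by rewrite invr_ge0 mulr_ge0 ?pi_ge0. Qed.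

(* The measure dtheta / (2 pi) carried by ]- pi, pi]. *)
Definition circle_measure : set (measurableTypeR R) -> \bar R :=
  mscale (NngNum inv2pi_ge0) (mrestr lebesgue_measure measurable_angles).

HB.instance Definition _ := Measure.on circle_measure.

Lemma circle_measure_setT : circle_measure setT = 1%E.
Proof.
rewrite /circle_measure /mscale /= /mrestr setTI lebesgue_measure_itv /=.
have pi0 : 0 < pi :> R := pi_gt0 R.
rewrite lte_fin gtrN // opprK -EFinD -EFinM; congr EFin.
by rewrite -mulr2n -[pi *+ 2]mulr_natl mulVf // mulf_neq0 ?pnatr_eq0 ?gt_eqF.
Qed.

HB.instance Definition _ :=
  Measure_isProbability.Build _ _ _ circle_measure circle_measure_setT.

Definition cons_angle (d : nat)
    (x : measurableTypeR R * d.-tuple (measurableTypeR R)) :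
  d.+1.-tuple (measurableTypeR R) := [the d.+1.-tuple _ of x.1 :: x.2].

Lemma measurable_cons_angle (d : nat) :
  measurable_fun [set: measurableTypeR R * d.-tuple (measurableTypeR R)]
    (@cons_angle d).
Proof. exact: measurable_cons. Qed.

HB.instance Definition _ (d : nat) :=
  isMeasurableFun.Build _ _ _ _ (@cons_angle d) (@measurable_cons_angle d).

(* dm, as the d-fold product of circle_measure: the measurable bijection
   cons_angle identifies R * R^d with R^(d+1). *)
Fixpoint torus_measure (d : nat) :
    probability (d.-tuple (measurableTypeR R)) R :=
  if d is d'.+1 then
    distribution (circle_measure \x torus_measure d')%E (@cons_angle d')
  else \d_([tuple] : 0.-tuple (measurableTypeR R)).

End TorusMeasure.

Section MomentMap.
Context {R : realType}.

Definition cintegral disp (T : measurableType disp)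
    (mu : {measure set T -> \bar R}) (f : T -> R[i]) : R[i] :=
  (\int[mu]_t complex.Re (f t)) +i* (\int[mu]_t complex.Im (f t)).

Definition expi (t : R) : R[i] := cos t +i* sin t.

Definition expi_row (d : nat) (theta : d.-tuple R) : 'rV[R[i]^o]_d :=
  \row_j expi (tnth theta j).

Definition torus (d : nat) : set 'rV[R[i]^o]_d :=
  [set z | forall j, `|z ord0 j| = 1].

(* Elements of C^0_+ are functions of z = e^{i theta}; only their values on the
   torus matter. *)
Definition C0plus (d : nat) : set ('rV[R[i]^o]_d -> R) :=
  [set Phi : _ -> R | {within @torus d, continuous Phi} /\
             forall z, @torus d z -> 0 < Phi z].

(* The Kronecker product v_0 *t (v_1 *t (... *t v_{d-1})). *)
Fixpoint kron_col (m d : nat) : ('I_d -> 'cV[R[i]]_m) -> 'cV[R[i]]_(m ^ d) :=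
  if d is d'.+1 return ('I_d -> 'cV[R[i]]_m) -> 'cV[R[i]]_(m ^ d) then
    fun v => castmx (esym (expnS m d'), muln1 1)
               (v ord0 *t kron_col (fun j => v (lift ord0 j)))
  else fun _ => const_mx 1.

Definition Kvec (n : nat) (z : R[i]) : 'cV[R[i]]_n.+1 :=
  \col_(k < n.+1) z ^+ k.

Definition K (n d : nat) (z : 'rV[R[i]^o]_d) : 'cV[R[i]]_(n.+1 ^ d) :=
  kron_col (fun j => Kvec n (z ord0 j)).

Definition Gamma (n d : nat) (Phi : 'rV[R[i]^o]_d -> R) :
    'M[R[i]]_(n.+1 ^ d) :=
  \matrix_(k, l) cintegral (torus_measure d) (fun theta =>
    let z := expi_row theta in
    (K n z *m (Phi z)%:C%:M *m (K n z) ^t*) k l).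

Definition posdefmx (N : nat) (A : 'M[R[i]]_N) : Prop :=
  A \is hermsymmx /\
  forall x : 'cV[R[i]]_N, x != 0 -> 0 < (x ^t* *m A *m x) ord0 ord0.

(* Convexity of this set is taken in the R[i]-module of matrices: the order on
   R[i] makes 0 <= t <= 1 imply that t is real, so the weights in {i01 R[i]} are
   exactly those of [0, 1]. *)
Definition Lplus (n d : nat) : set (convex_lmodType 'M[R[i]]_(n.+1 ^ d)) :=
  [set L | (@Gamma n d @` @C0plus d) L /\ posdefmx L].

End MomentMap.

(* Main.v *)
Require Import Defs.
From mathcomp Require Import all_boot all_order all_algebra.
From mathcomp Require Import spectral sesquilinear.
From mathcomp Require Import complex mxtens.
From mathcomp Require Import all_classical all_reals all_analysis.
From mathcomp Require Import measurable_realfun.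

Set Implicit Arguments.
Unset Strict Implicit.
Unset Printing Implicit Defensive.

Import Order.TTheory GRing.Theory Num.Theory.
Import numFieldNormedType.Exports.

Local Open Scope classical_set_scope.
Local Open Scope ring_scope.
Local Open Scope complex_scope.
Local Open Scope sesquilinear_scope.

(** The set [Lplus] is the intersection of the image of the convex set [C0plus]
    under [Gamma] with the convex cone of positive definite matrices, so it is
    convex as soon as [Gamma] commutes with convex combinations ([Gamma_comb]).
    The k, l entry of [Gamma Phi] is the integral of [Phi] against the fixed
    continuous function [gram_entry k l], the k, l entry of K K^H ([GammaE]);
    what has to be proved is therefore the linearity of these integrals.

    Linearity of the Lebesgue integral holds for integrable functions, and the
    substance of the proof is that every continuous function on the torus,
    pulled back along the angles, is integrable ([integrable_torus]). It is
    bounded because the torus is compact: it is a power of the unit circle, which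
    is the image of a segment under [expi] ([compact_torus]). It is measurable
    for the product sigma-algebra, the one generated by the coordinates, because
    it is the pointwise limit of the step functions obtained by rounding the
    angles down to the grids of mesh 1 / (k + 1) ([measurable_seq_continuous]). *)

(** * Measurability of continuous functions of finitely many real variables *)

Section MeasurableContinuous.
Context {R : realType}.

(** The preimage of any set is the union of countably many measurable fibres, so
    [F] needs no regularity. *)
Lemma measurable_fun_countable_factor disp (T : measurableType disp)
    disp' (U : measurableType disp') (C : countType) (h : T -> C) (F : C -> U) :
  (forall c, measurable (h @^-1` [set c])) -> measurable_fun setT (F \o h).
Proof.
move=> mh _ Y mY; rewrite setTI.
rewrite (_ : _ @^-1` _ =
    \bigcup_c (if pselect (Y (F c)) then h @^-1` [set c] else set0)).
  apply: countable_bigcupT_measurable; first exact: countableP.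
  by move=> c; case: pselect => /= ?.
apply/seteqP; split => [t Yt|t [c _]].
  by exists (h t) => //; case: pselect.
by case: pselect => // Yc /= ht; rewrite /= ht.
Qed.

Definition grid_index (d k : nat) (theta : d.-tuple R) : d.-tuple int :=
  [tuple Num.floor (tnth theta j * k.+1%:R) | j < d].

Definition grid_point (d k : nat) (m : d.-tuple int) : d.-tuple R :=
  [tuple (tnth m j)%:~R / k.+1%:R | j < d].

Lemma measurable_grid_index (d k : nat) (m : d.-tuple int) :
  measurable ((@grid_index d k : d.-tuple (measurableTypeR R) -> _) @^-1` [set m]).
Proof.
rewrite (_ : _ @^-1` _ = \bigcap_(j in [set: 'I_d])
   ((fun theta : d.-tuple (measurableTypeR R) => tnth theta j : measurableTypeR R) @^-1`
     [set x | Num.floor (x * k.+1%:R) = tnth m j])); last first.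
  apply/seteqP; split => theta /=.
    by move=> <- j _ /=; rewrite tnth_mktuple.
  by move=> h; apply: eq_from_tnth => j; rewrite tnth_mktuple; exact: h.
apply: fin_bigcap_measurable; first exact: finite_finset.
move=> j _; rewrite -[X in measurable X]setTI; apply: measurable_tnth => //.
rewrite (_ : [set x | _] =
    `[(tnth m j)%:~R / k.+1%:R, (tnth m j + 1)%:~R / k.+1%:R[%classic).
  exact: measurable_itv.
apply/seteqP; split => x /=; rewrite in_itv /= ler_pdivrMr// ltr_pdivlMr//.
  by move=> <-; exact: floor_itv.
exact: floor_def.
Qed.

Lemma cvg_grid_point (d : nat) (theta : d.-tuple R) j :
  (fun k => tnth (grid_point k (grid_index k theta)) j) @ \oo --> tnth theta j.
Proof.
apply/cvgrPdist_lt => /= e e0; near=> k.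
rewrite !tnth_mktuple; set x := tnth theta j.
have k0 : 0 < k.+1%:R :> R by [].
have := floor_itv (x * k.+1%:R); set f := Num.floor _ => /andP[fx xf].
rewrite -(@ltr_pM2r _ k.+1%:R)// -{2}[k.+1%:R]gtr0_norm// -normrM mulrBl divfK ?gt_eqF//.
rewrite ger0_norm ?subr_ge0//.
apply: (@lt_trans _ _ 1); first by rewrite ltrBlDl -[1]/(1%:~R) -intrD.
rewrite mulrC -ltr_pdivrMr// div1r.
rewrite invf_plt ?posrE//; near: k; exact: (near_infty_natSinv_lt (PosNum e0)).
Unshelve. all: by end_near. Qed.

(** Rounding each coordinate down to a multiple of 1 / (k + 1) takes countably
    many values, so composing [g] with it gives a measurable function; sequential
    continuity makes these compositions converge to [g]. *)
Lemma measurable_seq_continuous (d : nat) (g : d.-tuple R -> R) :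
  (forall (u : nat -> d.-tuple R) theta,
     (forall j, (fun k => tnth (u k) j) @ \oo --> tnth theta j) ->
     (g \o u) @ \oo --> g theta) ->
  measurable_fun [set: d.-tuple (measurableTypeR R)] g.
Proof.
move=> cg; apply: (@measurable_fun_cvg _ _ _ _
  (fun k theta => g (grid_point k (grid_index k theta)))).
  move=> k; apply: (@measurable_fun_countable_factor _ _ _ _ _
    (@grid_index d k) (g \o @grid_point d k)) => m.
  exact: measurable_grid_index.
by move=> theta _; apply: cg => j; exact: cvg_grid_point.
Qed.

End MeasurableContinuous.

(** * Integrability of continuous functions on the torus *)

Section Torus.
Context {R : realType}.

Lemma continuous_complex (T : topologicalType) (f g : T -> R) :
  continuous f -> continuous g ->
  continuous ((fun t => f t +i* g t) : T -> R[i]^o).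
Proof.
move=> cf cg t; apply/cvgrPdist_lt => /= e e0.
have [r r0 re] : exists2 r : R, 0 < r & e = r%:C.
  by case: e e0 => a b; rewrite ltcE /= => /andP[/eqP-> a0]; exists a.
near=> s.
have -> : (f t +i* g t) - (f s +i* g s) = (f t - f s) +i* (g t - g s) by [].
rewrite normc_def /= re ltcR.
apply: (@le_lt_trans _ _ (`|f t - f s| + `|g t - g s|)).
  (* the Euclidean norm is at most the l1 norm: compare the squares *)
  rewrite -[leRHS]ger0_norm ?addr_ge0// -[leRHS]sqrtr_sqr ler_wsqrtr//.
  rewrite [leRHS]sqrrD !real_normK ?num_real// addrAC lerDl.
  by rewrite mulrn_wge0// mulr_ge0.
rewrite (splitr r) ltrD//; near: s.
  have /cvgrPdist_lt := cf t; apply; exact: divr_gt0.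
have /cvgrPdist_lt := cg t; apply; exact: divr_gt0.
Unshelve. all: by end_near. Qed.

Lemma continuous_expi : continuous (expi : R -> R[i]^o).
Proof.
by apply: continuous_complex; [exact: continuous_cos|exact: continuous_sin].
Qed.

Lemma continuous_Re : continuous (@complex.Re R : R[i]^o -> R).
Proof.
move=> z A /= /nbhs_ballP[e e0 eA]; apply/nbhs_ballP.
exists e%:C; first by rewrite /= ltcR.
move=> w; rewrite -ball_normE /= => zw; apply: eA; rewrite -ball_normE /=.
rewrite -ltcR; apply: (le_lt_trans _ zw).
by rewrite -raddfB; exact: normc_ge_Re.
Qed.

Lemma continuous_Im : continuous (@complex.Im R : R[i]^o -> R).
Proof.
move=> z A /= /nbhs_ballP[e e0 eA]; apply/nbhs_ballP.
exists e%:C; first by rewrite /= ltcR.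
move=> w; rewrite -ball_normE /= => zw; apply: eA; rewrite -ball_normE /=.
rewrite -ltcR; apply: (le_lt_trans _ zw).
by rewrite -raddfB normc_def lecR -sqrtr_sqr ler_wsqrtr// lerDr sqr_ge0.
Qed.

Lemma continuous_conj : continuous (Num.conj : R[i]^o -> R[i]^o).
Proof.
move=> z A /= /nbhs_ballP[e e0 eA]; apply/nbhs_ballP; exists e => // w.
rewrite -ball_normE /= => zw; apply: eA; rewrite -ball_normE /=.
by rewrite -rmorphB norm_conjC.
Qed.

Lemma norm_expi (t : R) : `|expi t| = 1.
Proof. by rewrite normc_def /= cos2Dsin2 sqrtr1. Qed.

(** A point x + i y of the unit circle has the angle acos x or - acos x, according
    to the sign of y. *)
Lemma unit_circle_expi : [set z : R[i]^o | `|z| = 1] = expi @` `[- pi, pi].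
Proof.
apply/seteqP; split => [[x y] /=|_ [t _ <-]]; last exact: norm_expi.
rewrite normc_def /= => -[] /(congr1 (fun r => r ^+ 2)).
rewrite expr1n sqr_sqrtr ?addr_ge0 ?sqr_ge0// => xy1.
have xN11 : -1 <= x <= 1.
  by rewrite -ler_norml -(@ler_pXn2r _ 2) ?nnegrE// real_normK ?num_real//
     expr1n -xy1 lerDl sqr_ge0.
have a0 := acos_ge0 xN11; have api := acos_lepi xN11.
have sx : sin (acos x) = `|y|.
  by rewrite sin_acos// -xy1 addrAC subrr add0r sqrtr_sqr.
have [y0|y0] := leP 0 y.
  exists (acos x); last by rewrite /expi acosK// sx ger0_norm.
  by rewrite /= in_itv /= api andbT (le_trans _ a0)// oppr_le0 pi_ge0.
exists (- acos x); last by rewrite /expi cosN sinN acosK// sx ltr0_norm// opprK.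
by rewrite /= in_itv /= lerN2 api /= (le_trans _ (pi_ge0 R))// oppr_le0.
Qed.

Lemma compact_torus (d : nat) : compact (@torus R d).
Proof.
apply: (@rV_compact R[i]^o d (fun=> [set z : R[i]^o | `|z| = 1])) => _.
rewrite unit_circle_expi; apply: continuous_compact.
  exact/continuous_subspaceT/continuous_expi.
exact: segment_compact.
Qed.

Lemma torus_expi_row (d : nat) (theta : d.-tuple R) : torus (expi_row theta).
Proof. by move=> j; rewrite mxE norm_expi. Qed.

Lemma cvg_expi_row (d : nat) (u : nat -> d.-tuple R) (theta : d.-tuple R) :
  (forall j, (fun k => tnth (u k) j) @ \oo --> tnth theta j) ->
  (fun k => expi_row (u k)) @ \oo --> expi_row theta.
Proof.
move=> ut; apply/cvg_ballP => e e0.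
have : \forall k \near \oo, forall j : 'I_d,
    ball (expi (tnth theta j) : R[i]^o) e (expi (tnth (u k) j)).
  apply: filter_forall => j.
  have : (fun k => expi (tnth (u k) j) : R[i]^o) @ \oo --> (expi (tnth theta j) : R[i]^o).
    exact: cvg_comp (ut j) (@continuous_expi (tnth theta j)).
  by move=> /cvg_ballP; exact.
apply: filterS => k h; split => // i j; rewrite !mxE; exact: h.
Qed.

(** The measure is finite, so a bounded measurable function is integrable; the
    bound is the one given by compactness of the torus. *)
Lemma integrable_torus (d : nat) (f : 'rV[R[i]^o]_d -> R) :
  {within @torus R d, continuous f} ->
  (torus_measure d).-integrable setT (EFin \o (f \o @expi_row R d)).
Proof.
move=> cf; apply: measurable_bounded_integrable => //.
- by apply: (le_lt_trans (probability_le1 (torus_measure d) _)) => //; exact: ltry.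
- apply: measurable_seq_continuous => u theta ut.
  have /subspace_continuousP/(_ _ (torus_expi_row theta)) cft := cf.
  have ct : (fun k => expi_row (u k)) @ \oo -->
      within (@torus R d) (nbhs (expi_row theta)).
    move=> P nP; have h : \forall k \near \oo,
        torus (expi_row (u k)) -> P (expi_row (u k)) := cvg_expi_row ut nP.
    change (\forall k \near \oo, P (expi_row (u k))).
    by apply: filterS h => k; apply; exact: torus_expi_row.
  exact: cvg_comp ct cft.
- have /compact_bounded[M [Mr hM]] := continuous_compact cf (@compact_torus d).
  exists M; split => // y My theta _; apply: (hM _ My).
  by exists (expi_row theta) => //; exact: torus_expi_row.
Qed.

End Torus.

(** * Entries of the moment matrix *)

Section MomentMatrix.
Context {R : realType}.

(** An entry of the Kronecker product is an entry of the first factor times an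
    entry of the product of the remaining ones. *)
Lemma continuous_kron_col (T : topologicalType) (m d : nat)
    (v : T -> 'I_d -> 'cV[R[i]]_m) (k : 'I_(m ^ d)) :
  (forall j i, continuous (fun t => v t j i ord0 : R[i]^o)) ->
  continuous (fun t => kron_col (v t) k ord0 : R[i]^o).
Proof.
elim: d v k => [|d IH] v k cv t.
  rewrite /= (_ : (fun=> _) = cst 1); first exact: cvg_cst.
  by apply/funext => s; rewrite mxE.
pose k' := mxtens_unindex (cast_ord (expnS m d) k).
rewrite /= (_ : (fun=> _) = fun s => (v s ord0 k'.1 ord0 : R[i]^o) *
    (kron_col (fun j => v s (lift ord0 j)) k'.2 ord0 : R[i]^o)).
  by apply: cvgM; [exact: cv|apply: IH => j i; exact: cv].
apply/funext => s; rewrite castmxE mxE esymK.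
by rewrite !ord1.
Qed.

Lemma continuous_expc (T : topologicalType) (p : nat) (f : T -> R[i]^o) :
  continuous f -> continuous (fun t => f t ^+ p : R[i]^o).
Proof.
move=> cf; elim: p => [|p IHp] t.
  by under eq_fun do rewrite expr0; exact: cvg_cst.
under eq_fun do rewrite exprS.
by apply: cvgM; [exact: cf|exact: IHp].
Qed.

Lemma continuous_coord (d : nat) (j : 'I_d) :
  continuous (fun z : 'rV[R[i]^o]_d => z ord0 j).
Proof.
move=> z A /= /nbhs_ballP[e e0 es].
by apply/nbhs_ballP; exists e => //= x [_ zx]; apply: es; exact: zx.
Qed.

Lemma continuous_K (n d : nat) (k : 'I_(n.+1 ^ d)) :
  continuous (fun z : 'rV[R[i]^o]_d => K n z k ord0 : R[i]^o).
Proof.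
apply: continuous_kron_col => j i.
under eq_fun do rewrite mxE.
apply: continuous_expc; exact: continuous_coord.
Qed.

(** At z = e^(i theta) this is the trigonometric monomial e^(i <k - l, theta>), for
    k and l read as multi-indices in base n + 1. *)
Definition gram_entry (n d : nat) (k l : 'I_(n.+1 ^ d)) (z : 'rV[R[i]^o]_d) :
  R[i]^o := K n z k ord0 * Num.conj (K n z l ord0).

Lemma continuous_mulJ (T : topologicalType) (f g : T -> R[i]^o) :
  continuous f -> continuous g ->
  continuous (fun t => f t * Num.conj (g t) : R[i]^o).
Proof.
move=> cf cg t; apply: cvgM; first exact: cf.
exact: cvg_comp (cg t) (@continuous_conj R (g t)).
Qed.

Lemma continuous_gram_entry (n d : nat) (k l : 'I_(n.+1 ^ d)) :
  continuous (gram_entry k l).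
Proof. by apply: continuous_mulJ; exact: continuous_K. Qed.

Lemma continuous_Re_gram_entry (n d : nat) (k l : 'I_(n.+1 ^ d)) :
  continuous (fun z => complex.Re (gram_entry k l z)).
Proof.
move=> z; exact: cvg_comp (@continuous_gram_entry _ _ k l z) (@continuous_Re R _).
Qed.

Lemma continuous_Im_gram_entry (n d : nat) (k l : 'I_(n.+1 ^ d)) :
  continuous (fun z => complex.Im (gram_entry k l z)).
Proof.
move=> z; exact: cvg_comp (@continuous_gram_entry _ _ k l z) (@continuous_Im R _).
Qed.

Lemma Re_scale (a : R) (z : R[i]) : complex.Re (a%:C * z) = a * complex.Re z.
Proof. by case: z => x y /=; rewrite mul0r subr0. Qed.

Lemma Im_scale (a : R) (z : R[i]) : complex.Im (a%:C * z) = a * complex.Im z.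
Proof. by case: z => x y /=; rewrite mul0r addr0. Qed.

Lemma GammaE (n d : nat) (Phi : 'rV[R[i]^o]_d -> R) (k l : 'I_(n.+1 ^ d)) :
  Gamma n Phi k l =
    (\int[torus_measure d]_theta
       (Phi (expi_row theta) * complex.Re (gram_entry k l (expi_row theta)))) +i*
    (\int[torus_measure d]_theta
       (Phi (expi_row theta) * complex.Im (gram_entry k l (expi_row theta)))).
Proof.
have fE z : (K n z *m (Phi z)%:C%:M *m (K n z) ^t*) k l =
    (Phi z)%:C * gram_entry k l z.
  by rewrite mul_mx_scalar -scalemxAl mxE [in LHS]mxE big_ord1 !mxE.
rewrite mxE /cintegral; congr (_ +i* _); apply: eq_Rintegral => theta _;
  by rewrite /= fE ?Re_scale ?Im_scale.
Qed.

End MomentMatrix.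

(** * Convexity *)

Section Convexity.
Context {R : realType}.

Lemma Rintegral_comb (d : nat) (a b : R) (Phi Psi h : 'rV[R[i]^o]_d -> R) :
  {within @torus R d, continuous Phi} -> {within @torus R d, continuous Psi} ->
  continuous h ->
  \int[torus_measure d]_theta
     ((a * Phi (expi_row theta) + b * Psi (expi_row theta)) * h (expi_row theta)) =
  a * \int[torus_measure d]_theta (Phi (expi_row theta) * h (expi_row theta)) +
  b * \int[torus_measure d]_theta (Psi (expi_row theta) * h (expi_row theta)).
Proof.
move=> cPhi cPsi ch.
have int c (F : 'rV[R[i]^o]_d -> R) : {within @torus R d, continuous F} ->
   (torus_measure d).-integrable setT
     (EFin \o (fun theta => c * (F (expi_row theta) * h (expi_row theta)))).
  move=> cF; apply: (@integrable_torus _ _ (fun z => c * (F z * h z))) => z.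
  apply: cvgM; first exact: cvg_cst.
  by apply: cvgM; [exact: cF|exact: continuous_subspaceT].
have int1 (F : 'rV[R[i]^o]_d -> R) : {within @torus R d, continuous F} ->
   (torus_measure d).-integrable setT
     (EFin \o (fun theta => F (expi_row theta) * h (expi_row theta))).
  move=> cF; have := int 1 _ cF; apply: eq_integrable => // theta _ /=.
  by rewrite mul1r.
rewrite -!RintegralZl ?int1// -RintegralD ?int//.
by apply: eq_Rintegral => theta _; rewrite mulrDl !mulrA.
Qed.

Lemma Gamma_comb (n d : nat) (a b : R) (Phi Psi : 'rV[R[i]^o]_d -> R) :
  {within @torus R d, continuous Phi} -> {within @torus R d, continuous Psi} ->
  Gamma n (fun z => a * Phi z + b * Psi z) =
  a%:C *: Gamma n Phi + b%:C *: Gamma n Psi.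
Proof.
have entryE (A B : 'M[R[i]]_(n.+1 ^ d)) k l :
    (a%:C *: A + b%:C *: B) k l = a%:C * A k l + b%:C * B k l.
  by rewrite !mxE.
move=> cPhi cPsi; apply/matrixP => k l.
apply: etrans (GammaE _ k l) _.
apply: etrans (esym (entryE _ _ k l)).
(* explicit instances, so that unification never compares the integrals of Phi
   and of Psi *)
apply: etrans (congr2 (fun x y => a%:C * x + b%:C * y)
  (esym (GammaE Phi k l)) (esym (GammaE Psi k l))).
rewrite (Rintegral_comb _ _ cPhi cPsi (@continuous_Re_gram_entry R _ _ k l)).
rewrite (Rintegral_comb _ _ cPhi cPsi (@continuous_Im_gram_entry R _ _ k l)).
by apply/eqP; rewrite eq_complex /= !mul0r !subr0 !addr0 !eqxx.
Qed.

Lemma convex_comb_gt0 (F : numDomainType) (a b x y : F) :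
  0 <= a -> 0 <= b -> a + b = 1 -> 0 < x -> 0 < y -> 0 < a * x + b * y.
Proof.
move=> a0 b0 ab1 x0 y0; rewrite lt_neqAle addr_ge0 ?mulr_ge0 ?(ltW x0) ?(ltW y0)//.
rewrite andbT eq_sym paddr_eq0 ?mulr_ge0 ?(ltW x0) ?(ltW y0)//.
rewrite !mulf_eq0 (gt_eqF x0) (gt_eqF y0) !orbF.
apply/negP => /andP[/eqP a00 /eqP b00]; move: ab1; rewrite a00 b00 addr0.
by move=> /eqP; rewrite eq_sym oner_eq0.
Qed.

Lemma C0plus_comb (d : nat) (a b : R) (Phi Psi : 'rV[R[i]^o]_d -> R) :
  0 <= a -> 0 <= b -> a + b = 1 -> C0plus Phi -> C0plus Psi ->
  C0plus (fun z => a * Phi z + b * Psi z).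
Proof.
move=> a0 b0 ab1 [cPhi Phi0] [cPsi Psi0]; split => [z|z tz].
  by apply: cvgD; apply: cvgM; [exact: cvg_cst|exact: cPhi|exact: cvg_cst|exact: cPsi].
by apply: convex_comb_gt0 => //; [exact: Phi0|exact: Psi0].
Qed.

Lemma posdefmx_comb (N : nat) (a b : R) (A B : 'M[R[i]]_N) :
  0 <= a -> 0 <= b -> a + b = 1 -> posdefmx A -> posdefmx B ->
  posdefmx (a%:C *: A + b%:C *: B).
Proof.
move=> a0 b0 ab1 [hA pA] [hB pB]; split => [|x x0].
  apply/is_hermitianmxP; rewrite expr0 scale1r.
  move/is_hermitianmxP: hA; move/is_hermitianmxP: hB.
  rewrite !expr0 !scale1r => hB hA.
  rewrite {1}hA {1}hB; apply/matrixP => i j; rewrite !mxE rmorphD !rmorphM /=.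
  by congr (_ * _ + _ * _); rewrite conj_Creal ?complex_real.
rewrite mulmxDr mulmxDl -!scalemxAr -!scalemxAl mxE [X in X + _]mxE [X in _ + X]mxE.
apply: convex_comb_gt0; rewrite ?lecR//; [|exact: pA|exact: pB].
by rewrite -rmorphD ab1.
Qed.

End Convexity.

Theorem mainTheorem2 (R : realType) (d n : nat)
    (hd : (1 <= d)%N) (hn : (1 <= n)%N) :
  convex_set (@Lplus R n d).
Proof.
move=> L1 L2 t /set_mem[[Phi CPhi <-] pd1] /set_mem[[Psi CPsi <-] pd2].
apply: mem_set.
(* a weight of R[i] with 0 <= t <= 1 is real *)
have [a tE] : exists a : R, t%:num = a%:C.
  by apply/complex_realP; rewrite realE ge0.
have a0 : 0 <= a by rewrite -lecR -tE ge0.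
have a1 : 0 <= 1 - a by rewrite subr_ge0 -lecR -tE le1.
have a1E : a + (1 - a) = 1 by rewrite addrC subrK.
have bE : 1 - t%:num = (1 - a)%:C by rewrite tE rmorphB.
have convE (A B : convex_lmodType 'M[R[i]]_(n.+1 ^ d)) :
    conv t A B = a%:C *: (A : 'M[R[i]]_(n.+1 ^ d)) + (1 - a)%:C *: B.
  by rewrite -tE -bE.
rewrite convE.
split; last exact: posdefmx_comb.
exists (fun z => a * Phi z + (1 - a) * Psi z); first exact: C0plus_comb.
by case: CPhi CPsi => [cPhi _] [cPsi _]; exact: Gamma_comb.
Qed.
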